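(* Let $K$ be a b-bounded b-convex body in a Minkowski space $(\mathbb{R}^n,\|\cdot\|)$ and let $S \subseteq K$. Then $\operatorname{bh}_1(S)=K$ if and only if every exposed b-face of $K$ meets $\operatorname{cl}(S)$ (i.e., has non-empty intersection with $\operatorname{cl}(S)$).
   Context: A Minkowski space $(\mathbb{R}^n,\|\cdot\|)$ is $\mathbb{R}^n$, $n\ge 1$, equipped with an arbitrary norm. For $x\in\mathbb{R}^n$ and $r\ge 0$, $B(x,r)=\{y:\|y-x\|\le r\}$ is the closed ball and $S(x,r)=\{y:\|y-x\|=r\}$ the sphere; $\operatorname{cl}$ denotes closure. The ball hull of $S\subseteq\mathbb{R}^n$ is $\operatorname{bh}_1(S)=\bigcap_{x\in\mathbb{R}^n:\,S\subseteq B(x,1)}B(x,1)$, where the intersection of an empty family is $\mathbb{R}^n$. A set $S$ is b-convex if $S=\operatorname{bh}_1(S)$; a b-convex body is a bounded non-empty b-convex set. A supporting sphere of a b-convex body $K$ is a sphere $S(x,1)$ of radius $1$ with $K\subseteq B(x,1)$ and $K\cap S(x,1)\neq\emptyset$; the set $K\cap S(x,1)$ is then called an exposed b-face of $K$. The circumradius $\operatorname{rad}(S)$ is the least $r\ge 0$ such that $S$ is contained in some ball $B(x,r)$ (and $+\infty$ if $S$ is unbounded). A set $S$ is b-bounded if $\operatorname{rad}(S)<1$. *)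

(* Defs.v *)
From HB Require Import structures.
From mathcomp Require Import all_boot all_order all_algebra.
From mathcomp Require Import all_classical all_reals all_analysis.

Set Implicit Arguments.
Unset Strict Implicit.
Unset Printing Implicit Defensive.

Import Order.TTheory GRing.Theory Num.Theory.
Import numFieldNormedType.Exports.

Local Open Scope classical_set_scope.
Local Open Scope ring_scope.

(* Nonnegativity and the value 0 at 0 follow from these three axioms. *)
Record vnorm (R : realType) (n : nat) := VNorm {
  vnorm_fun :> 'rV[R]_n -> R ;
  vnormD : forall x y, vnorm_fun (x + y) <= vnorm_fun x + vnorm_fun y ;
  vnormZ : forall (a : R) x, vnorm_fun (a *: x) = `|a| * vnorm_fun x ;
  vnorm0_eq0 : forall x, vnorm_fun x = 0 -> x = 0 }.

(* A copy of 'rV[R]_n, needed because 'rV[R]_n itself already carries the sup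
   norm as its canonical norm.  Norm, topology and boundedness on
   [minkowski_space N] are those induced by N. *)
Definition minkowski_space (R : realType) (n : nat) (N : vnorm R n) : Type :=
  'rV[R]_n.

Section MinkowskiInstances.
Variables (R : realType) (n : nat) (N : vnorm R n).

HB.instance Definition _ := GRing.Lmodule.copy (minkowski_space N) 'rV[R]_n.

HB.instance Definition _ := Lmodule_isNormed.Build R (minkowski_space N)
  (vnormD N) (vnormZ N) (@vnorm0_eq0 R n N).

Lemma minkowski_space_normE (x : minkowski_space N) : `|x| = N x.
Proof. by []. Qed.

End MinkowskiInstances.

Section BallConvexity.
Variables (R : realType) (V : normedModType R).
Implicit Types (x : V) (r : R) (S K F : set V).

(* The library's [closed_ball x r] is the closure of the open ball, hence empty
   for r = 0; [closed_ball_] is the set of all y with `|x - y| <= r. *)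
Definition cball x r : set V := closed_ball_ Num.norm x r.

Definition sphere x r : set V := [set y | `|x - y| = r].

Definition ball_hull S : set V :=
  \bigcap_(x in [set x | S `<=` cball x 1]) cball x 1.

Definition b_convex S : Prop := S = ball_hull S.

Definition b_convex_body K : Prop :=
  [/\ bounded_set K, K !=set0 & b_convex K].

Definition supporting_sphere K x : Prop :=
  K `<=` cball x 1 /\ K `&` sphere x 1 !=set0.

Definition exposed_b_face K F : Prop :=
  exists2 x, supporting_sphere K x & F = K `&` sphere x 1.

(* The infimum of the empty set is +oo, the value for unbounded S. *)
Definition circumradius S : \bar R :=
  ereal_inf [set r%:E | r in [set r | 0 <= r /\ exists x, S `<=` cball x r]].

Definition b_bounded S : Prop := (circumradius S < 1%:E)%E.

End BallConvexity.

(* Main.v *)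
Require Import Defs.
From mathcomp Require Import all_boot all_order all_algebra.
From mathcomp Require Import all_classical all_reals all_analysis.
From mathcomp Require Import lra.

(** Both directions slide the centre of a unit ball along a line and use that,
    for a compact set, missing the sphere of a ball that contains it means
    staying at positive distance from that sphere
    ([compact_subset_smaller_cball]).

    If an exposed b-face [K `&` sphere x 1] misses the closure of [S], then [S]
    lies in a ball of radius [1 - e] around [x].  Moving the centre by [e] away
    from a point [p] of the face keeps [S] inside the unit ball but expels
    [p], so [p] belongs to [K] but not to the ball hull of [S]
    ([exposed_b_face_meets_closure]).

    Conversely, if the ball hull of [S] is smaller than [K], some unit ball
    around [x] contains [S] but not [K].  As [K] is b-bounded it lies in a ball
    of radius [r < 1] around some [z].  On the way from [x] to [z] there is a
    first centre [w] whose unit ball contains all of [K], and there [K] touches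
    the sphere ([supporting_sphere_between]).  By convexity of the norm [w] is
    at distance less than [1], uniformly, from all points of [S], so the exposed
    b-face at [w] misses the closure of [S].

    Finite dimension enters only through compactness of [K]: the identity from
    the sup norm to the given norm is continuous, and the given norm is bounded
    below by a positive multiple of the sup norm, so Heine-Borel carries over
    ([minkowski_bounded_closed_compact]). *)

Set Implicit Arguments.
Unset Strict Implicit.
Unset Printing Implicit Defensive.

Import Order.TTheory GRing.Theory Num.Theory.
Import numFieldNormedType.Exports.

Local Open Scope classical_set_scope.
Local Open Scope ring_scope.

Section CompactBodies.
Variables (R : realType) (V : normedModType R).
Implicit Types (x z p : V) (r t : R) (A S K : set V).

Lemma closed_cball x r : closed (cball x r).
Proof. exact: closed_closed_ball_. Qed.

Lemma closed_ball_hull S : closed (ball_hull S).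
Proof. by apply: closed_bigI => x _; exact: closed_cball. Qed.

Lemma closure_subset_closed S A : closed A -> S `<=` A -> closure S `<=` A.
Proof. by move=> clA SA x; rewrite closureEbigcap; exact. Qed.

Lemma compact_subset_smaller_cball A x r : compact A ->
  (forall y, A y -> `|x - y| < r) ->
  exists2 e, 0 < e & A `<=` cball x (r - e).
Proof.
move=> cA Ar; have [A0|/set0P/negP/negPn/eqP ->] := pselect (A !=set0); last first.
  by exists 1 => // y [].
have /(compact_EVT_max A0 cA)[c /set_mem Ac cmax] :
    {within A, continuous (fun y => `|x - y|)}.
  apply: continuous_subspaceT => y; apply: cvg_norm.
  by apply: cvgB; [exact: cvg_cst|exact: cvg_id].
exists (r - `|x - c|); first by rewrite subr_gt0 Ar.
by move=> y Ay; rewrite /cball /closed_ball_ /= subKr cmax ?inE.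
Qed.

(** A point [p] of a face missing [closure S] is cut off from [S] by the unit
    ball whose centre is moved away from [p] by the gap between [S] and the
    sphere. *)
Lemma exposed_b_face_meets_closure K S : compact K -> S `<=` K ->
  ball_hull S = K ->
  forall F, exposed_b_face K F -> F `&` closure S !=set0.
Proof.
move=> cK SK hSK F [x [Kx [p [Kp xp]]] ->].
apply/not_existsP => disj.
have clSK : closure S `<=` K.
  by apply: closure_subset_closed SK; apply: compact_closed => //; exact: norm_hausdorff.
have ccS : compact (closure S).
  by apply: (subclosed_compact _ cK clSK); exact: closed_closure.
have [y clSy|e e0 Se] := compact_subset_smaller_cball (x := x) (r := 1) ccS.
  have Ky := clSK _ clSy.
  rewrite lt_neqAle; apply/andP; split; last exact: Kx.
  by apply/eqP => xy; exact: (disj y).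
set w := x + e *: (x - p).
have Sw : S `<=` cball w 1.
  move=> y /subset_closure/Se; rewrite /cball /closed_ball_ /= => xy.
  have -> : w - y = (x - y) + e *: (x - p) by rewrite /w addrAC.
  by rewrite (le_trans (ler_normD _ _))// normrZ xp gtr0_norm//; lra.
have : cball w 1 p by move: Kp; rewrite -hSK => /(_ w); exact.
rewrite /cball /closed_ball_ /=.
have -> : w - p = (1 + e) *: (x - p) by rewrite /w scalerDl scale1r addrAC.
by rewrite normrZ xp gtr0_norm; lra.
Qed.

(** Among the centres [x + t *: (z - x)] with [0 <= t] whose unit ball contains
    [K], the one with least [t] works: were [K] off its sphere, a slightly
    smaller [t] would still do.  That [t] is positive, since [t = 0] gives the
    centre [x]. *)
Lemma supporting_sphere_between K x z : compact K ->
  K `<=` cball z 1 -> ~ K `<=` cball x 1 ->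
  exists2 t, 0 < t <= 1 & supporting_sphere K (x + t *: (z - x)).
Proof.
move=> cK Kz Kx; pose w t := x + t *: (z - x).
pose D := `|z - x|.
have D1 : 0 < D + 1 by rewrite ltr_wpDl ?normr_ge0.
have wD s t y : `|w s - y| <= `|w t - y| + `|s - t| * D.
  have -> : w s - y = (w t - y) + (s - t) *: (z - x).
    by rewrite /w scalerBl [RHS]addrAC -[x + t *: _ + _]addrA [t *: _ + _]addrC subrK.
  by rewrite (le_trans (ler_normD _ _))// normrZ.
pose T := [set t | 0 <= t /\ K `<=` cball (w t) 1].
have T1 : T 1 by split; rewrite // /w scale1r addrC subrK.
have lbT : lbound T 0 by move=> t [].
have hT : has_inf T by split; [exists 1|exists 0].
set m := inf T.
have m0 : 0 <= m by apply: lb_le_inf => //; exists 1.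
(* The infimum is attained: the constraint is closed in [t], by [wD]. *)
have Km : K `<=` cball (w m) 1.
  move=> y Ky; rewrite /cball /closed_ball_ /=; apply/ler_addgt0Pr => e e0.
  have [t [t0 Kt] tm] := inf_adherent (divr_gt0 e0 D1) hT.
  have mt : m <= t by apply: ge_inf => //; exists 0.
  apply: (le_trans (wD m t y)); apply: lerD; first exact: Kt.
  rewrite distrC ger0_norm ?subr_ge0//.
  have : t - m <= e / (D + 1) by rewrite lerBlDl ltW.
  rewrite ler_pdivlMr// mulrDr => /(le_trans _) -> //.
  by rewrite mulr1 lerDl subr_ge0.
have m_gt0 : 0 < m.
  rewrite lt_neqAle m0 andbT; apply/eqP => m00.
  by apply: Kx; move: Km; rewrite -m00 /w scale0r addr0.
exists m; first by rewrite m_gt0 ge_inf//; exists 0.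
split=> //; apply/not_existsP => disj.
have [y Ky|e e0 Ke] := compact_subset_smaller_cball (x := w m) (r := 1) cK.
  rewrite lt_neqAle; apply/andP; split; last exact: Km.
  by apply/eqP => wy; exact: (disj y).
(* The centre moves at speed [D], so moving [t] back by [e / (D + 1)] uses up
   at most the gap [e]; the [+ 1] makes positivity of the denominator evident. *)
pose s := Num.max 0 (m - e / (D + 1)).
have sm : s < m by rewrite gt_max m_gt0 ltrBlDr ltrDl divr_gt0.
suff /(ge_inf (ex_intro _ 0 lbT)) : T s by rewrite leNgt sm.
split; first by rewrite le_max lexx.
move=> y Ky; rewrite /cball /closed_ball_ /=; apply: (le_trans (wD s m y)).
have := Ke _ Ky; rewrite /cball /closed_ball_ /= => wy.
have ms : m - s <= e / (D + 1) by rewrite lerBlDr -lerBlDl le_max lexx orbT.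
have -> : `|s - m| = m - s by rewrite distrC gtr0_norm ?subr_gt0.
suff : (m - s) * D <= e by move: wy; lra.
move: ms; rewrite ler_pdivlMr// mulrDr => /(le_trans _) -> //.
by rewrite mulr1 lerDl subr_ge0 ltW.
Qed.

(** A unit ball containing [S] but not [p] can be pushed towards a smaller ball
    containing [K] until it supports [K]; [S] then lies strictly inside it, so
    the face found there is out of reach of [closure S]. *)
Lemma ball_hull_eq_of_faces K S : compact K -> b_convex K -> b_bounded K ->
  S `<=` K ->
  (forall F, exposed_b_face K F -> F `&` closure S !=set0) ->
  ball_hull S = K.
Proof.
move=> cK bK /ereal_inf_lt[_ [r [_ [z Kz]] <-]]; rewrite lte_fin => r1 SK face.
apply/seteqP; split.
  rewrite [X in _ `<=` X]bK => p hp x Kx; apply: hp.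
  exact: subset_trans Kx.
move=> p Kp x Sx; apply: contrapT => xp.
have Kz1 : K `<=` cball z 1.
  by move=> y /Kz zy; apply: le_trans zy _; exact: ltW.
have [|t /andP[t0 t1] supp] := supporting_sphere_between cK Kz1 (x := x).
  by move=> /(_ p Kp).
set w := x + t *: (z - x) in supp.
have Sw : closure S `<=` cball w (1 - t * (1 - r)).
  apply: closure_subset_closed; first exact: closed_cball.
  move=> y Sy; have := Sx _ Sy; have := Kz _ (SK _ Sy).
  rewrite /cball /closed_ball_ /= => zy xy.
  have -> : w - y = (1 - t) *: (x - y) + t *: (z - y).
    rewrite scalerBl scale1r -[RHS]addrA [- _ + _]addrC -scalerBr opprB addrA subrK.
    by rewrite /w addrAC.
  apply: (le_trans (ler_normD _ _)); rewrite !normrZ !ger0_norm ?subr_ge0 ?(ltW t0)//.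
  have t1_ge0 : 0 <= 1 - t by rewrite subr_ge0.
  apply: (le_trans (lerD (ler_wpM2l t1_ge0 xy) (ler_wpM2l (ltW t0) zy))).
  lra.
have [] := face _ (ex_intro2 _ _ w supp erefl).
move=> y [[_ wy] /Sw]; rewrite /cball /closed_ball_ /= wy; nra.
Qed.

End CompactBodies.

Section FiniteDimension.
Variables (R : realType) (n : nat) (N : vnorm R n).

(** The identity, read as a map from the sup-norm topology to the topology of
    [N]. *)
Definition to_minkowski (x : 'rV[R]_n) : minkowski_space N := x.

Lemma minkowski_norm_le_sup :
  exists2 C, 0 < C & forall x : 'rV[R]_n, `|to_minkowski x| <= C * `|x|.
Proof.
exists (1 + \sum_(i < n) `|to_minkowski (delta_mx 0 i)|).
  by rewrite ltr_pwDl// sumr_ge0.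
move=> x; rewrite mulrDl mul1r ler_wpDl// mulr_suml.
have -> : to_minkowski x = \sum_(i < n) x 0 i *: to_minkowski (delta_mx 0 i).
  exact: row_sum_delta.
apply: (le_trans (ler_norm_sum _ _ _)); apply: ler_sum => i _.
rewrite normrZ mulrC ler_wpM2l//.
rewrite [leRHS]mx_normrE.
by apply: (le_trans _ (le_bigmax _ _ (0, i))).
Qed.

Lemma to_minkowski_continuous : continuous to_minkowski.
Proof.
have [C C0 NC] := minkowski_norm_le_sup.
move=> x; apply: (iffRL (@cvgrPdist_lt _ _ _ _ (nbhs_filter x) _ _)) => e e0.
have eC : 0 < e / C by exact: divr_gt0.
apply: filterS (nbhsx_ballx x _ eC) => y; rewrite mx_norm_ball /ball_ /= => xy.
rewrite -[to_minkowski x - _]/(to_minkowski (x - y)).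
by apply: (le_lt_trans (NC _)); rewrite mulrC -ltr_pdivlMr.
Qed.

(** The constant is the minimum of the given norm on the sup-norm unit sphere,
    or [1] in dimension 0, where that sphere is empty. *)
Lemma sup_norm_le_minkowski :
  exists2 c, 0 < c & forall x : 'rV[R]_n, c * `|x| <= `|to_minkowski x|.
Proof.
pose U := [set x : 'rV[R]_n | `|x| = 1].
have normc : continuous (fun x : 'rV[R]_n => `|to_minkowski x|).
  move=> x; apply: (@continuous_comp _ _ _ to_minkowski Num.norm).
    exact: to_minkowski_continuous.
  exact: norm_continuous.
have [c c0 Uc] : exists2 c, 0 < c & forall x, U x -> c <= `|to_minkowski x|.
  have [U0|/set0P/negP/negPn/eqP ->] := pselect (U !=set0); last by exists 1.
  have cU : compact U.
    apply: bounded_closed_compact.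
      by exists 1; split; [exact: num_real|move=> M M1 x /= ->; exact: ltW].
    rewrite (_ : U = (fun x : 'rV[R]_n => `|x|) @^-1` [set 1])//.
    by apply: closed_comp => [x _|]; [exact: norm_continuous|exact: closed_eq].
  have [v /set_mem Uv vmin] := EVT_min_rV U0 cU (continuous_subspaceT normc).
  exists `|to_minkowski v|; last by move=> x Ux; apply: vmin; rewrite inE.
  rewrite normr_gt0; apply/eqP => v0; move: Uv; rewrite /U /=.
  by rewrite (_ : v = 0)// normr0 => /eqP; rewrite eq_sym oner_eq0.
exists c => // x; have [->|x0] := eqVneq x 0; first by rewrite normr0 mulr0.
have nx : 0 < `|x| by rewrite normr_gt0.
have := Uc (`|x|^-1 *: x); rewrite /U /= normrZ ger0_norm ?invr_ge0// mulVf ?gt_eqF//.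
move=> /(_ erefl).
rewrite -[to_minkowski _]/(`|x|^-1 *: to_minkowski x) normrZ.
by rewrite ger0_norm ?invr_ge0// mulrC ler_pdivlMr.
Qed.

(** By Heine-Borel for the sup norm: the two norm comparisons make
    the preimage under the identity bounded and closed for the sup norm, and its
    image compact for [N]. *)
Lemma minkowski_bounded_closed_compact (A : set (minkowski_space N)) :
  bounded_set A -> closed A -> compact A.
Proof.
move=> bA clA.
have [c c0 Nc] := sup_norm_le_minkowski.
have cA : compact (to_minkowski @^-1` A).
  apply: bounded_closed_compact; last first.
    by apply: closed_comp => // x _; exact: to_minkowski_continuous.
  have [M [_ AM]] := bA.
  exists (c^-1 * (M + 1)); split; first exact: num_real.
  move=> m mM x Ax; apply/ltW/(le_lt_trans _ mM).
  rewrite mulrC ler_pdivlMr// mulrC (le_trans (Nc x))//.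
  by apply: AM => //; rewrite ltrDl.
have -> : A = to_minkowski @` (to_minkowski @^-1` A).
  by apply/seteqP; split=> [x Ax|x [y Ay <-]//]; exists x.
apply: continuous_compact => //.
exact/continuous_subspaceT/to_minkowski_continuous.
Qed.

End FiniteDimension.

Theorem theorem3 (R : realType) (n : nat) (hn : (0 < n)%N) (N : vnorm R n)
    (K S : set (minkowski_space N)) (hK : b_convex_body K) (hKb : b_bounded K)
    (hSK : S `<=` K) :
  ball_hull S = K <->
  forall F : set (minkowski_space N), exposed_b_face K F -> F `&` closure S !=set0.
Proof.
have [bK _ cvxK] := hK.
have clK : closed K by rewrite cvxK; exact: closed_ball_hull.
have cK : compact K by exact: minkowski_bounded_closed_compact.
split; first exact: exposed_b_face_meets_closure.
exact: ball_hull_eq_of_faces.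
Qed.
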